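(* Let $(\nu(i))_{i\ge0}$ be a positive decreasing sequence such that $\sum_{i=0}^{\infty}\sqrt{\nu(i)/(i+1)}<\infty$ and $$E\big((f(X_{i,m})-f(X_i))^2\big)\le \nu(i)\quad\text{for all integers } i,m\ge 0 .$$ For $j\ge 0$ put $\overline{\nu}(j)=\sum_{i=j}^{\infty}\sqrt{\nu(i)/(i+1)}$. Then $E(f(X_h))$ has a finite limit $\mu$ as $h\to\infty$. Moreover, for every integer $h\ge0$, $$|E(f(X_h))-\mu|\le\sqrt{\nu(h)},$$ and for all integers $h\ge 0$ and $k>0$, $$\Big|E\Big(\frac1k\sum_{i=h}^{h+k-1}f(X_i)\Big)-\mu\Big|\le\frac{\overline{\nu}(\lfloor h/2\rfloor)}{\sqrt k}$$ and $$E\Big(\Big(\frac1k\sum_{i=h}^{h+k-1}f(X_i)-\mu\Big)^2\Big)\le\frac{26\,(\overline{\nu}(0))^2}{k}.$$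
   Context: Setting: $F,F'$ are measurable spaces, $g:F\times F'\to F$ is measurable, $(U_i)_{i\in\mathbb Z}$ are i.i.d. $F'$-valued random variables, $X_0\in F$ is deterministic, and $X_{i+1}=g(X_i,U_i)$ for $i\ge0$. The function $f:F\to\mathbb R$ is measurable and $f(X_i)$ is square-integrable for every $i\ge0$. For $m\in\mathbb Z$, the sequence $(X_{i,m})_{i\ge -m}$ is defined by $X_{-m,m}=X_0$ and $X_{i+1,m}=g(X_{i,m},U_i)$ for $i\ge -m$ (same $U_i$); in particular $X_{i,0}=X_i$ for $i\ge 0$. *)

(* Defs.v *)
From HB Require Import structures.
From mathcomp Require Import all_boot all_order all_algebra finmap.
From mathcomp Require Import all_classical all_reals all_analysis.

Set Implicit Arguments.
Unset Strict Implicit.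
Unset Printing Implicit Defensive.

Import Order.TTheory GRing.Theory Num.Theory.
Import numFieldNormedType.Exports.

Local Open Scope classical_set_scope.
Local Open Scope ring_scope.

Section independence.
Context {d d' : measure_display} {T : measurableType d}
  {T' : measurableType d'} {R : realType} (P : probability T R) {I : choiceType}.
Implicit Type Y : I -> {RV P >-> T'}.

Definition mutually_independent Y : Prop :=
  forall (J : {fset I}) (A : I -> set T'),
    (forall i, measurable (A i)) ->
    P (\bigcap_(i in [set` J]) (Y i @^-1` A i)) =
    (\prod_(i <- J) P (Y i @^-1` A i))%E.

(* [distribution P (Y i)] is a total function on sets, so equality in law is
   only required on measurable sets. *)
Definition identically_distributed Y : Prop :=
  forall (i j : I) (A : set T'), measurable A ->
    distribution P (Y i) A = distribution P (Y j) A.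

Definition iid Y : Prop := mutually_independent Y /\ identically_distributed Y.

End independence.

Arguments mutually_independent {d d' T T' R} P {I} Y.
Arguments identically_distributed {d d' T T' R} P {I} Y.
Arguments iid {d d' T T' R} P {I} Y.

Section chain.
Context {T F F' : Type} (g : F * F' -> F) (x0 : F) (U : int -> T -> F').

(* State reached after [n] steps by the chain that is at [x0] at time [s]. *)
Fixpoint chain_from (s : int) (n : nat) (w : T) : F :=
  if n is n'.+1 then g (chain_from s n' w, U (s + n'%:Z) w) else x0.

(* X_i *)
Definition chain (i : nat) : T -> F := chain_from 0 i.

(* X_{i,m}; meaningful for [- m <= i] only. *)
Definition shifted_chain (i m : int) : T -> F := chain_from (- m) (absz (i + m)).

Lemma chain0 w : chain 0 w = x0.
Proof. by []. Qed.

Lemma chainS i w : chain i.+1 w = g (chain i w, U i%:Z w).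
Proof. by rewrite /chain /= add0r. Qed.

Lemma shifted_chain_start m w : shifted_chain (- m) m w = x0.
Proof. by rewrite /shifted_chain addNr. Qed.

Lemma shifted_chain_step (i m : int) w : - m <= i ->
  shifted_chain (i + 1) m w = g (shifted_chain i m w, U i w).
Proof.
rewrite -subr_ge0 opprK /shifted_chain addrAC => im.
rewrite -[in LHS](gez0_abs im) -PoszD absz_nat addn1 /=.
by rewrite gez0_abs// addrCA addNr addr0.
Qed.

Lemma shifted_chain0 (i : nat) : shifted_chain i%:Z 0 = chain i.
Proof. by rewrite /shifted_chain /chain oppr0 addr0. Qed.

End chain.

Definition nubar {R : realType} (nu : R^nat) (j : nat) : \bar R :=
  (\sum_(j <= i <oo) (Num.sqrt (nu i / i.+1%:R))%:E)%E.

(* Main.v *)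
Require Import Defs.
From mathcomp Require Import all_boot all_order all_algebra finmap.
From mathcomp Require Import ring lra zify.
From mathcomp Require Import all_classical all_reals all_analysis.
From mathcomp Require Import measurable_realfun.

(** Telescope [f X_n] along the dyadic scales [j = 1, 2, 4, ...], where the
    approximation of scale [j] restarts the chain from [x0] at time [n - j].
    Shifting the innovations shows that the increment between the scales [j]
    and [2 j] has second moment at most [nu j], and it only depends on the last
    [2 j] innovations, so that its sum over [k] consecutive times has variance
    [O(k j nu j)]. By Minkowski's inequality the standard deviation of the whole
    sum is at most a multiple of [sqrt k] times the sum over [r] of
    [sqrt (2 ^ r * nu (2 ^ r))], which is comparable to [nubar nu 0] since [nu]
    is nonincreasing. The bias of [f X_i] is at most [sqrt (nu i)], and Abel
    summation compares the average of these numbers to [nubar nu (h %/ 2)]. *)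

Set Implicit Arguments.
Unset Strict Implicit.
Unset Printing Implicit Defensive.

Import Order.TTheory GRing.Theory Num.Theory.
Import numFieldNormedType.Exports.

Local Open Scope classical_set_scope.
Local Open Scope ring_scope.

(** * Independence of the sigma-algebras generated by disjoint sets of variables *)

Section cylinder.
Context {d d' : measure_display} {T : measurableType d}
  {T' : measurableType d'} {R : realType} (P : probability T R) {I : choiceType}.
Variable Y : I -> {RV P >-> T'}.

(** A pi-system generating the sigma-algebra of the [Y i] with [i] in [J]. *)
Definition cylinder (J : set I) : set_system T :=
  [set E | exists K : {fset I}, exists A : I -> set T',
    [/\ [set` K] `<=` J, forall i, measurable (A i) &
        E = \bigcap_(i in [set` K]) (Y i @^-1` A i)] ].

Lemma cylinder_setI_closed J : setI_closed (cylinder J).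
Proof.
move=> _ _ [K [A [KJ mA ->]]] [K' [A' [KJ' mA' ->]]].
pose B i := (if i \in K then A i else setT) `&` (if i \in K' then A' i else setT).
exists (K `|` K')%fset, B; split.
- by move=> i /=; rewrite in_fsetU => /orP[/KJ|/KJ'].
- by move=> i; apply: measurableI; case: ifP.
- apply/seteqP; split => [w [wA wA'] i /= _|w wB].
    split; first by case: ifPn => // iK; exact: wA.
    by case: ifPn => // iK; exact: wA'.
  split=> i /= iK.
    have [|] := wB i; first by rewrite /= in_fsetU iK.
    by rewrite iK.
  have [|_] := wB i; first by rewrite /= in_fsetU iK orbT.
  by rewrite iK.
Qed.

Lemma cylinder_measurable J : cylinder J `<=` measurable.
Proof.
move=> _ [K [A [_ mA ->]]]; apply: fin_bigcap_measurable => // i _.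
exact: measurable_funPTI.
Qed.

Lemma sub_cylinder J J' : J `<=` J' -> cylinder J `<=` cylinder J'.
Proof.
move=> JJ' E [K [A [KJ mA ->]]]; exists K, A; split => //.
exact: subset_trans JJ'.
Qed.

Hypothesis indepY : mutually_independent P Y.

Lemma cylinder_indep J J' E E' : J `&` J' = set0 ->
  cylinder J E -> cylinder J' E' -> P (E `&` E') = (P E * P E')%E.
Proof.
move=> JJ' [K [A [KJ mA ->]]] [K' [A' [KJ' mA' ->]]].
(* Since [K] and [K'] are disjoint, one family of sides describes both events, and independence over
   the union splits into the two products. *)
pose B i := if i \in K then A i else A' i.
have KK' i : i \in K -> i \in K' -> False.
  by move=> /KJ iJ /KJ' iJ'; have : set0 i by rewrite -JJ'; split.
have mB i : measurable (B i) by rewrite /B; case: ifP.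
have -> : \bigcap_(i in [set` K]) (Y i @^-1` A i) `&`
    \bigcap_(i in [set` K']) (Y i @^-1` A' i) =
    \bigcap_(i in [set` (K `|` K')%fset]) (Y i @^-1` B i).
  apply/seteqP; split => [w [wA wA'] i /=|w wB].
    rewrite in_fsetU /B; case: ifPn => [iK _|_ /= iK']; first exact: wA.
    exact: wA'.
  split=> i /= iK; have := wB i; rewrite /= in_fsetU iK ?orbT /B => /(_ isT).
    by rewrite iK.
  by case: ifPn => // /KK'; case/(_ iK).
have KK'E : perm_eq (K `|` K')%fset (K ++ K').
  apply: uniq_perm => [||i]; rewrite ?fset_uniq ?mem_cat ?in_fsetU//.
  rewrite cat_uniq !fset_uniq/= andbT; apply/hasPn => i iK'.
  by apply/negP => /KK'; exact.
rewrite !indepY// (perm_big _ KK'E) big_cat/=.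
congr (_ * _)%E; rewrite big_seq [RHS]big_seq; apply: eq_bigr => i iK.
  by rewrite /B iK.
by rewrite /B; case: ifPn => // /KK'; case/(_ iK).
Qed.

Lemma g_sigma_cylinder_measurable J : <<s cylinder J >> `<=` measurable.
Proof.
apply: smallest_sub; last exact: cylinder_measurable.
exact: sigma_algebra_measurable.
Qed.

(** Dynkin's argument: the measurable events independent of the fixed [E] form a lambda-system,
    which contains the sigma-algebra as soon as it contains the pi-system [G]. *)
Lemma indep_event_g_sigma (G : set_system T) E : setI_closed G ->
  G `<=` measurable -> measurable E ->
  (forall A, G A -> P (A `&` E) = (P A * P E)%E) ->
  forall A, <<s G >> A -> P (A `&` E) = (P A * P E)%E.
Proof.
move=> GI Gm mE GE.
pose H := [set A | measurable A /\ P (A `&` E) = (P A * P E)%E].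
suff : <<s G >> `<=` H by move=> sub A /sub[].
apply: lambda_system_subset => //; last first.
  by move=> A GA; split; [exact: Gm|exact: GE].
apply/dynkin_lambda_system; split.
- by split; [exact: measurableT|rewrite setTI probability_setT mul1e].
- move=> A [mA AE]; split; first exact: measurableC.
  rewrite probability_setC// muleBl// ?fin_num_adde_defl ?fin_num_measure//.
  have PEoo : (P E < +oo)%E by rewrite -ge0_fin_numE// fin_num_measure.
  by rewrite mul1e -AE setIC -setDE measureD// setIC.
- move=> F tF FH; have mF n : measurable (F n) by have [] := FH n.
  split; first exact: bigcupT_measurable.
  rewrite setI_bigcupl measure_bigcup//=; last 2 first.
  + by move=> n _; exact: measurableI.
  + exact: trivIset_setIr.
  have PE : P E = (fine (P E))%:E by rewrite fineK ?fin_num_measure.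
  rewrite measure_bigcup//= muleC PE -nneseriesZl//.
  by apply: eq_eseriesr => n _; have [_ ->] := FH n; rewrite -PE muleC.
Qed.

(** The pi-lambda argument is used twice: with [E'] fixed it reduces [E] to a cylinder, and with
    that cylinder fixed it reduces [E'] to one. *)
Lemma g_sigma_cylinder_indep J J' E E' : J `&` J' = set0 ->
  <<s cylinder J >> E -> <<s cylinder J' >> E' ->
  P (E `&` E') = (P E * P E')%E.
Proof.
move=> JJ' JE JE'.
apply: (indep_event_g_sigma (@cylinder_setI_closed J)) JE.
- exact: cylinder_measurable.
- exact: g_sigma_cylinder_measurable JE'.
- move=> A JA; rewrite setIC muleC.
  apply: (indep_event_g_sigma (@cylinder_setI_closed J')) JE'.
  + exact: cylinder_measurable.
  + exact: cylinder_measurable JA.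
  + by move=> B JB; apply: cylinder_indep JB JA; rewrite setIC.
Qed.

End cylinder.

(** * Joint laws of independent variables *)

Section joint_law.
Context {d d1 d2 : measure_display} {T : measurableType d}
  {S1 : measurableType d1} {S2 : measurableType d2} {R : realType}
  (P : probability T R).

Definition independent (X : T -> S1) (Y : T -> S2) := forall A B,
  measurable A -> measurable B ->
  P (X @^-1` A `&` Y @^-1` B) = (P (X @^-1` A) * P (Y @^-1` B))%E.

Definition same_law {d'} {S : measurableType d'} (X X' : T -> S) :=
  forall A, measurable A -> P (X @^-1` A) = P (X' @^-1` A).

(** Both measures agree on measurable rectangles, which determine the product measure. *)
Lemma independent_joint_law (X : {RV P >-> S1}) (Y : {RV P >-> S2})
    (mXY : measurable_fun setT (fun w => (X w, Y w))) : independent X Y ->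
  forall C, measurable C ->
    (distribution P X \x distribution P Y)%E C =
    distribution P (mfun_Sub (mem_set mXY)) C.
Proof.
by move=> indXY; apply: product_measure_unique => A B mA mB; exact: indXY.
Qed.

(** By independence, both joint laws are the product of the same marginals. *)
Lemma same_law_pair (X X' : T -> S1) (Y Y' : T -> S2) :
  measurable_fun setT X -> measurable_fun setT Y ->
  measurable_fun setT X' -> measurable_fun setT Y' ->
  independent X Y -> independent X' Y' ->
  same_law X X' -> same_law Y Y' ->
  same_law (fun w => (X w, Y w)) (fun w => (X' w, Y' w)).
Proof.
move=> mX mY mX' mY' XY XY' lX lY C mC.
have mXY : measurable_fun setT (fun w => (X w, Y w)) by exact: measurable_fun_pair.
have mXY' : measurable_fun setT (fun w => (X' w, Y' w)).
  exact: measurable_fun_pair.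
pose rX : {RV P >-> S1} := mfun_Sub (mem_set mX).
pose rY : {RV P >-> S2} := mfun_Sub (mem_set mY).
transitivity ((distribution P rX \x distribution P rY)%E C).
  by rewrite (@independent_joint_law rX rY mXY).
apply: (@product_measure_unique _ _ _ _ _ _ _
  (distribution P (mfun_Sub (mem_set mXY')))) => // A B mA mB.
transitivity (P (X' @^-1` A) * P (Y' @^-1` B))%E; first exact: XY'.
by congr (_ * _)%E; [rewrite -lX|rewrite -lY].
Qed.

Lemma same_law_comp (X X' : T -> S1) (h : S1 -> S2) : measurable_fun setT h ->
  same_law X X' -> same_law (h \o X) (h \o X').
Proof.
move=> mh lX A mA; apply: (lX (h @^-1` A)).
by rewrite -[_ @^-1` _]setTI; exact: mh.
Qed.

End joint_law.

(** * Integrals under equality in law *)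

Section same_law_real.
Context {d d' : measure_display} {T : measurableType d} {S : measurableType d'}
  {R : realType} (P : probability T R).

Lemma same_law_distribution (X X' : {RV P >-> S}) : same_law P X X' ->
  forall h : S -> \bar R,
  (\int[distribution P X]_x h x = \int[distribution P X']_x h x)%E.
Proof. by move=> lX h; apply: eq_measure_integral => A mA _; exact: lX. Qed.

Lemma same_law_ge0_integral (X X' : T -> S) (h : S -> \bar R) :
  measurable_fun setT X -> measurable_fun setT X' -> measurable_fun setT h ->
  (forall x, 0 <= h x)%E -> same_law P X X' ->
  (\int[P]_w h (X w) = \int[P]_w h (X' w))%E.
Proof.
move=> mX mX' mh h0 lX.
pose rX : {RV P >-> S} := mfun_Sub (mem_set mX).
pose rX' : {RV P >-> S} := mfun_Sub (mem_set mX').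
rewrite -[LHS](ge0_integral_distribution rX)//.
rewrite -[RHS](ge0_integral_distribution rX')//.
exact: same_law_distribution.
Qed.

(** The positive and negative parts are transferred separately, by the nonnegative case. *)
Lemma same_law_integral (X X' : T -> S) (h : S -> \bar R) :
  measurable_fun setT X -> measurable_fun setT X' -> measurable_fun setT h ->
  same_law P X X' ->
  (\int[P]_w h (X w) = \int[P]_w h (X' w))%E.
Proof.
move=> mX mX' mh lX; rewrite integralE [RHS]integralE.
congr (_ - _)%E.
- rewrite (funepos_comp h X) (funepos_comp h X').
  exact: (same_law_ge0_integral mX mX' (measurable_funepos mh)).
- rewrite (funeneg_comp h X) (funeneg_comp h X').
  exact: (same_law_ge0_integral mX mX' (measurable_funeneg mh)).
Qed.

End same_law_real.

(** * Real-valued expectations and products of independent variables *)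

Section mean.
Context {d : measure_display} {T : measurableType d} {R : realType}
  (P : probability T R).
Implicit Types X Y : T -> R.

(** [fine] sends infinite values to 0, so this number is meaningful for [X] in [Lfun P 1]. *)
Definition mean X : R := fine 'E_P[X]%E.

Lemma meanE X : X \in Lfun P 1 -> 'E_P[X]%E = (mean X)%:E.
Proof. by move=> X1; rewrite /mean fineK ?expectation_fin_num. Qed.

Lemma Lfun21 X : X \in Lfun P 2%:E -> X \in Lfun P 1.
Proof. by move=> X2; rewrite (Lfun_subset12 _ X2)// fin_num_measure. Qed.

Lemma Lfun_measurable p X : X \in Lfun P p -> measurable_fun setT X.
Proof. by move=> /sub_Lfun_mfun; rewrite inE. Qed.

Lemma mean_cst c : mean (cst c) = c.
Proof. by rewrite /mean expectation_cst. Qed.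

Lemma meanD X Y : X \in Lfun P 1 -> Y \in Lfun P 1 ->
  mean (X + Y) = mean X + mean Y.
Proof.
by move=> X1 Y1; rewrite /mean expectationD// fineD// expectation_fin_num.
Qed.

Lemma meanB X Y : X \in Lfun P 1 -> Y \in Lfun P 1 ->
  mean (X - Y) = mean X - mean Y.
Proof.
by move=> X1 Y1; rewrite /mean expectationB// fineB// expectation_fin_num.
Qed.

Lemma meanZ k X : X \in Lfun P 1 -> mean (k *: X) = k * mean X.
Proof.
move=> X1; rewrite /mean.
have -> : k *: X = (k \o* X)%R by apply/funext => w; rewrite /= mulrC.
by rewrite expectationZl// meanE.
Qed.

Lemma mean_sum (I : eqType) (r : seq I) (X : I -> T -> R) :
  (forall i, i \in r -> X i \in Lfun P 1) ->
  mean (\sum_(i <- r) X i) = \sum_(i <- r) mean (X i).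
Proof.
elim: r => [|i r IHr] X1; first by rewrite !big_nil mean_cst.
have Xr j : j \in r -> X j \in Lfun P 1 by move=> jr; rewrite X1// inE jr orbT.
rewrite !big_cons meanD ?IHr ?X1 ?mem_head//.
by rewrite big_seq rpred_sum.
Qed.

Lemma mean_ge0 X : (forall w, 0 <= X w) -> 0 <= mean X.
Proof. by move=> X0; rewrite fine_ge0// expectation_ge0. Qed.

Lemma le_mean X Y : X \in Lfun P 1 -> Y \in Lfun P 1 ->
  (forall w, X w <= Y w) -> mean X <= mean Y.
Proof.
move=> X1 Y1 XY; rewrite -subr_ge0 -meanB// mean_ge0// => w.
by rewrite fctE subr_ge0.
Qed.

Lemma Lfun2_mulr X Y : X \in Lfun P 2%:E -> Y \in Lfun P 2%:E ->
  X * Y \in Lfun P 1.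
Proof. exact: Lfun2_mul_Lfun1. Qed.

Lemma Lfun2B X Y : X \in Lfun P 2%:E -> Y \in Lfun P 2%:E ->
  X - Y \in Lfun P 2%:E.
Proof. by move=> X2 Y2; rewrite rpredB ?lee1n. Qed.

Lemma Lfun2Z (c : R) X : X \in Lfun P 2%:E -> c *: X \in Lfun P 2%:E.
Proof. by move=> X2; rewrite rpredZ ?lee1n. Qed.

Lemma Lfun2_sum (I : eqType) (r : seq I) (X : I -> T -> R) :
  (forall i, i \in r -> X i \in Lfun P 2%:E) ->
  \sum_(i <- r) X i \in Lfun P 2%:E.
Proof. by move=> X2; rewrite big_seq rpred_sum ?lee1n. Qed.

Lemma mean_sqr_ge X : X \in Lfun P 2%:E -> mean X ^+ 2 <= mean (X ^+ 2).
Proof.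
move=> X2; have := variance_ge0 P X; rewrite varianceE//.
rewrite expr2 (meanE (Lfun2_mulr X2 X2)) (meanE (Lfun21 X2)).
by rewrite -EFin_expe -EFinB lee_fin subr_ge0.
Qed.

(** Moves integrability and the mean to the law of [Z] on the real line, where Fubini's theorem is
    to be applied. *)
Lemma distribution_mean (Z : {RV P >-> R}) : (Z : T -> R) \in Lfun P 1 ->
  (distribution P Z).-integrable setT EFin /\
  (\int[distribution P Z]_x x%:E = (mean Z)%:E)%E.
Proof.
move=> Z1; have iZ := (Lfun1_integrable P Z).1 Z1.
have mE := @EFin_measurable R setT.
split; last by rewrite -meanE// unlock integral_distribution.
apply/integrableP; split => //.
rewrite ge0_integral_distribution//; last exact: measurableT_comp.
by case/integrableP : iZ.
Qed.

(** Fubini's theorem for [z.1 * z.2] under the product of the two laws; square integrability makes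
    this function integrable. *)
Lemma independent_mean_mul X Y : X \in Lfun P 2%:E -> Y \in Lfun P 2%:E ->
  independent P X Y -> mean (X * Y) = mean X * mean Y.
Proof.
move=> X2 Y2 indXY.
have mX := Lfun_measurable X2; have mY := Lfun_measurable Y2.
have mXY : measurable_fun setT (fun w => (X w, Y w)) by exact: measurable_fun_pair.
pose rX : {RV P >-> R} := mfun_Sub (mem_set mX).
pose rY : {RV P >-> R} := mfun_Sub (mem_set mY).
pose rXY : {RV P >-> _} := mfun_Sub (mem_set mXY).
have lawXY C : measurable C ->
    (distribution P rX \x distribution P rY)%E C = distribution P rXY C.
  exact: (@independent_joint_law _ _ _ _ _ _ _ _ rX rY mXY).
pose h (z : R * R) : \bar R := (z.1 * z.2)%:E.
have mh : measurable_fun setT h.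
  by apply/measurable_EFinP; apply: measurable_funM.
have lawh (k : R * R -> \bar R) :
    (\int[distribution P rX \x distribution P rY]_z k z =
     \int[distribution P rXY]_z k z)%E.
  by apply: eq_measure_integral => C mC _; exact: lawXY.
have iXY : P.-integrable setT (h \o rXY).
  by apply/Lfun1_integrable; exact: Lfun2_mulr.
have ih : (distribution P rX \x distribution P rY)%E.-integrable setT h.
  apply/integrableP; split => //; rewrite lawh.
  rewrite ge0_integral_distribution//; last exact: measurableT_comp.
  by case/integrableP : iXY.
have [iX EX] := distribution_mean (Lfun21 X2 : (rX : T -> R) \in Lfun P 1).
have [iY EY] := distribution_mean (Lfun21 Y2 : (rY : T -> R) \in Lfun P 1).
apply: EFin_inj; rewrite -meanE ?Lfun2_mulr//.
transitivity (\int[distribution P rX \x distribution P rY]_z h z)%E.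
  by rewrite lawh integral_distribution// unlock.
rewrite -(integral12_prod_meas1 ih)/fubini_F /h/=.
under eq_integral do (under eq_integral do rewrite EFinM; rewrite integralZl// EY).
by rewrite integralZr// EX.
Qed.

End mean.

(** * Second moments of sums *)

Section mean_square.
Context {d : measure_display} {T : measurableType d} {R : realType}
  (P : probability T R).

Definition centered (X : T -> R) : T -> R := X - cst (mean P X).

Lemma centered_Lfun2 (X : T -> R) : X \in Lfun P 2%:E ->
  centered X \in Lfun P 2%:E.
Proof. by move=> X2; apply: Lfun2B => //; exact: Lfun_cst. Qed.

Lemma mean_centered (X : T -> R) : X \in Lfun P 1 -> mean P (centered X) = 0.
Proof. by move=> X1; rewrite meanB ?Lfun_cst// mean_cst subrr. Qed.

Lemma centeredB (X Y : T -> R) : X \in Lfun P 1 -> Y \in Lfun P 1 ->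
  centered (X - Y) = centered X - centered Y.
Proof.
move=> X1 Y1; apply/funext => w.
by rewrite /centered meanB// !fctE; ring.
Qed.

Lemma mean_sqr_shift (X : T -> R) b : X \in Lfun P 2%:E ->
  mean P ((X + cst b) ^+ 2) = mean P (X ^+ 2) + 2 * b * mean P X + b ^+ 2.
Proof.
move=> X2; have X1 := Lfun21 X2; have XX1 := Lfun2_mulr X2 X2.
have -> : (X + cst b) ^+ 2 = X * X + ((2 * b) *: X + cst (b ^+ 2)).
  by apply/funext => w; rewrite !fctE /GRing.scale/=; ring.
rewrite meanD ?rpredD ?rpredZ ?Lfun_cst// meanD ?rpredZ ?Lfun_cst// meanZ//.
by rewrite mean_cst expr2 addrA.
Qed.

Lemma mean_sqr_centered_le (X : T -> R) : X \in Lfun P 2%:E ->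
  mean P (centered X ^+ 2) <= mean P (X ^+ 2).
Proof.
move=> X2.
have -> : centered X = X + cst (- mean P X) by apply/funext.
by rewrite mean_sqr_shift//; have := sqr_ge0 (mean P X); nra.
Qed.

(** Minkowski's inequality in squared form. Expanding [0 <= E (y X - x Y) ^ 2] gives
    [2 x y E (X Y) <= 2 (x y) ^ 2], and dividing by [2 x y > 0] bounds the cross term by [x y]. *)
Lemma mean_sqrD_le (X Y : T -> R) (x y : R) :
  X \in Lfun P 2%:E -> Y \in Lfun P 2%:E -> 0 < x -> 0 < y ->
  mean P (X ^+ 2) <= x ^+ 2 -> mean P (Y ^+ 2) <= y ^+ 2 ->
  mean P ((X + Y) ^+ 2) <= (x + y) ^+ 2.
Proof.
move=> X2 Y2 x0 y0 Xx Yy.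
have XX1 := Lfun2_mulr X2 X2; have YY1 := Lfun2_mulr Y2 Y2.
have XY1 := Lfun2_mulr X2 Y2.
have expand (a b : R) : mean P ((a *: X + b *: Y) ^+ 2) =
    a ^+ 2 * mean P (X ^+ 2) + 2 * a * b * mean P (X * Y) +
    b ^+ 2 * mean P (Y ^+ 2).
  have -> : (a *: X + b *: Y) ^+ 2 =
      a ^+ 2 *: (X * X) + ((2 * a * b) *: (X * Y) + b ^+ 2 *: (Y * Y)).
    by apply/funext => w; rewrite !fctE /GRing.scale/=; ring.
  by rewrite !(meanD, meanZ) ?rpredD ?rpredZ// !expr2; ring.
have := @mean_ge0 _ _ _ P ((y *: X + (- x) *: Y) ^+ 2).
rewrite expand => /(_ (fun w => sqr_ge0 _)) XY0.
rewrite -[X]scale1r -[Y]scale1r expand.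
have xy0 : 0 < x * y by rewrite mulr_gt0.
have : mean P (X * Y) <= x * y.
  rewrite -(ler_pM2l xy0); nra.
by rewrite !expr1n; nra.
Qed.

(** When the square is expanded, only pairs at distance less than [m] survive. Each index has at
    most [2 m - 1] such partners, itself included, and each mean product is at most [v] because
    [2 a b <= a ^ 2 + b ^ 2]. *)
Lemma mean_sqr_sum_le (D : nat -> T -> R) (m h k : nat) (v : R) : 0 <= v ->
  (forall n, D n \in Lfun P 2%:E) ->
  (forall n, mean P (D n ^+ 2) <= v) ->
  (forall n n', (n + m <= n')%N -> mean P (D n * D n') = 0) ->
  mean P ((\sum_(h <= n < h + k) D n) ^+ 2) <= k%:R * ((m.*2).-1%:R * v).
Proof.
move=> v0 D2 Dv Dm.
rewrite expr2 mulr_sumr mean_sum; last first.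
  by move=> n' _; rewrite Lfun2_mulr// Lfun2_sum.
have cross n n' : mean P (D n * D n') <= v.
  have le : mean P (2 *: (D n * D n')) <= mean P (D n ^+ 2 + D n' ^+ 2).
    apply: le_mean.
    - by rewrite rpredZ// Lfun2_mulr.
    - by rewrite rpredD// Lfun2_mulr.
    - move=> w; rewrite !fctE /GRing.scale/=.
      by have := sqr_ge0 (D n w - D n' w); nra.
  rewrite meanZ ?Lfun2_mulr// meanD ?Lfun2_mulr// in le.
  by have := Dv n; have := Dv n'; lra.
pose near n n' := (n < n' + m)%N && (n' < n + m)%N.
have -> : k%:R * ((m.*2).-1%:R * v) = \sum_(h <= n < h + k) (m.*2).-1%:R * v.
  by rewrite sumr_const_nat addKn mulr_natl.
apply: ler_sum => n' _.
rewrite mulr_suml mean_sum; last by move=> n _; rewrite Lfun2_mulr.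
apply: (@le_trans _ _ (\sum_(h <= n < h + k | near n n') v)).
  rewrite [leRHS]big_mkcond/=; apply: ler_sum => n _; rewrite /near.
  case: ltnP => [nn'|n'n]; last by rewrite mulrC Dm.
  by case: ltnP => [//|n'n]; rewrite Dm.
rewrite big_const_seq iter_addr_0 -[leLHS]mulr_natl ler_wpM2r// ler_nat.
rewrite -size_filter.
apply: (@leq_trans (size (index_iota (n'.+1 - m) (n' + m)))).
  apply: uniq_leq_size; first by rewrite filter_uniq// iota_uniq.
  by move=> n; rewrite mem_filter !mem_index_iota /near; lia.
by rewrite size_iota; lia.
Qed.

End mean_square.

(** * Estimates for nonincreasing real sequences *)

Section real_sums.
Context {R : realType}.
Variable s : nat -> R.
Hypotheses (s0 : forall i, 0 <= s i) (sdecr : nonincreasing_seq s).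

(** For [s i = sqrt (nu i)] these are the partial sums of [nubar nu j]. *)
Definition weighted_sum (j n : nat) : R :=
  \sum_(j <= i < n) s i / Num.sqrt i.+1%:R.

Lemma sqrt_nat_gt0 n : 0 < Num.sqrt n.+1%:R :> R.
Proof. by rewrite sqrtr_gt0. Qed.

Lemma sum_inv_sqrt_ge (j n : nat) :
  (n - j)%:R <= Num.sqrt n%:R * \sum_(j <= i < n) (Num.sqrt i.+1%:R)^-1 :> R.
Proof.
rewrite -[(n - j)%:R]mulr_natl mulr1 -[leLHS]mulr1 mulr_natl -sumr_const_nat.
rewrite mulr_sumr.
rewrite big_nat [leRHS]big_nat; apply: ler_sum => i /andP[_ ni].
by rewrite ler_pdivlMr ?sqrt_nat_gt0// mul1r ler_sqrt ?ler_nat.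
Qed.

(** Each of the [n - j] terms is at least [s n / sqrt n], by monotonicity. This serves both for the
    dyadic blocks and for the decay of [s]. *)
Lemma weighted_sum_ge (j n : nat) :
  (n - j)%:R * s n <= Num.sqrt n%:R * weighted_sum j n.
Proof.
apply: (@le_trans _ _
    (Num.sqrt n%:R * (\sum_(j <= i < n) (Num.sqrt i.+1%:R)^-1) * s n)).
  by rewrite ler_wpM2r// sum_inv_sqrt_ge.
rewrite -mulrA ler_wpM2l ?sqrtr_ge0// mulr_suml big_nat [leRHS]big_nat.
apply: ler_sum => i /andP[_ ni]; rewrite mulrC ler_wpM2r ?invr_ge0 ?sqrtr_ge0//.
exact/sdecr/ltnW.
Qed.

Lemma weighted_sum_ge0 j n : 0 <= weighted_sum j n.
Proof. by apply: sumr_ge0 => i _; rewrite divr_ge0 ?sqrtr_ge0. Qed.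

Lemma le_weighted_sum j n n' : (n <= n')%N ->
  weighted_sum j n <= weighted_sum j n'.
Proof.
move=> nn'; have [jn|nj] := leqP j n; last first.
  by rewrite {1}/weighted_sum big_geq ?weighted_sum_ge0// ltnW.
rewrite /weighted_sum (big_cat_nat jn nn')/= lerDl.
exact: weighted_sum_ge0.
Qed.

Lemma weighted_sum_cat j m n : (j <= m <= n)%N ->
  weighted_sum j n = weighted_sum j m + weighted_sum m n.
Proof. by move=> /andP[jm mn]; rewrite /weighted_sum (big_cat_nat jm mn). Qed.

(* The term of scale [2 ^ r.+1] is paid for by the block [2 ^ r <= i < 2 ^ r.+1]
   of the weighted sum; hence the shift between both sides. *)
Lemma dyadic_sum_le (L : nat) :
  s 0 + \sum_(r < L.+1) 2 * Num.sqrt (2 ^ r)%:R * s (2 ^ r)%N <=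
  4 * weighted_sum 0 (2 ^ L).
Proof.
elim: L => [|L IH].
  rewrite big_ord1 expn0 sqrtr1 /weighted_sum big_nat1 sqrtr1 divr1 mulr1.
  by have := s0 0; have := sdecr (leq0n 1); lra.
rewrite big_ord_recr/= addrA (@weighted_sum_cat 0 (2 ^ L) (2 ^ L.+1)); last first.
  by rewrite leq0n leq_exp2l//=.
rewrite mulrDr; apply: lerD => //.
have := weighted_sum_ge (2 ^ L) (2 ^ L.+1).
have -> : (2 ^ L.+1 - 2 ^ L = 2 ^ L)%N by rewrite expnS; lia.
have N0 : 0 < Num.sqrt (2 ^ L.+1)%:R :> R by rewrite sqrtr_gt0 ltr0n expn_gt0.
have : (2 ^ L.+1)%:R = Num.sqrt (2 ^ L.+1)%:R ^+ 2 :> R by rewrite sqr_sqrtr.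
rewrite [(2 ^ L.+1)%:R in LHS](_ : _ = 2 * (2 ^ L)%:R); last by rewrite expnS natrM.
(* With [q ^ 2 = 2 ^ L.+1], dividing the block inequality by [q] bounds the block below by
   [q * s (2 ^ L.+1) / 2]; the new term [2 * q * s (2 ^ L.+1)] is four times this. *)
move: (Num.sqrt _) N0 => q q0 qE.
have -> : (2 ^ L)%:R = q ^+ 2 / 2 :> R by lra.
rewrite (_ : _ * s _ = q * (q * s (2 ^ L.+1)%N / 2)); last by ring.
by rewrite ler_pM2l//; lra.
Qed.

(** The sum is at least [(h + p - h %/ 2) / sqrt (h + p)]. Starting at half of [h] is enough since
    [(h / 2 + p) ^ 2 >= (h + p) * p]. *)
Lemma sqrt_le_sum_inv_sqrt (h p : nat) :
  Num.sqrt p%:R <= \sum_(h %/ 2 <= i < h + p) (Num.sqrt i.+1%:R)^-1 :> R.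
Proof.
have [/eqP|hp0] := eqVneq (h + p)%N 0%N.
  rewrite addn_eq0 => /andP[/eqP-> /eqP->].
  by rewrite sqrtr0 sumr_ge0// => i _; rewrite invr_ge0 sqrtr_ge0.
have q0 : 0 < Num.sqrt (h + p)%:R :> R by rewrite sqrtr_gt0 ltr0n lt0n.
rewrite -(ler_pM2l q0); apply: le_trans (sum_inv_sqrt_ge _ _).
rewrite -sqrtrM// -[leRHS]ger0_norm// -sqrtr_sqr ler_wsqrtr//.
rewrite -natrM -natrX ler_nat.
have : (h %/ 2 * 2 <= h)%N by exact: leq_trunc_div.
by move: (h %/ 2)%N => j jh; nia.
Qed.

(* Abel summation against the nonincreasing [s]: it suffices to compare the
   partial sums of the two weights, which is [sqrt_le_sum_inv_sqrt]. *)
Lemma sum_le_weighted_sum (h k : nat) :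
  \sum_(h <= i < h + k) s i <= Num.sqrt k%:R * weighted_sum (h %/ 2) (h + k).
Proof.
(* Surplus of one weight over the other after [p] terms; it is nonnegative for [p <= k], as
   [p = sqrt p * sqrt p <= sqrt k * sqrt p]. *)
pose G p : R := Num.sqrt k%:R * (\sum_(h %/ 2 <= i < h + p) (Num.sqrt i.+1%:R)^-1)
  - p%:R.
have G0 p : (p <= k)%N -> 0 <= G p.
  move=> pk; rewrite subr_ge0 -[leLHS]sqr_sqrtr// expr2.
  by rewrite ler_pM ?sqrtr_ge0 ?sqrt_le_sum_inv_sqrt// ler_wsqrtr// ler_nat.
have h2 p : (h %/ 2 <= h + p)%N by rewrite (leq_trans (leq_div h 2))// leq_addr.
suff main p : (p <= k)%N -> s (h + p)%N * G p <=
    Num.sqrt k%:R * weighted_sum (h %/ 2) (h + p) - \sum_(h <= i < h + p) s i.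
  by rewrite -subr_ge0; apply: le_trans (main k (leqnn k)); rewrite mulr_ge0 ?G0.
elim: p => [_|p IH pk].
  rewrite /G addn0 [in leRHS]big_geq// !subr0 mulrCA.
  rewrite ler_wpM2l ?sqrtr_ge0// mulr_sumr big_nat [leRHS]big_nat.
  apply: ler_sum => i /andP[_ ih]; rewrite ler_wpM2r ?invr_ge0 ?sqrtr_ge0//.
  exact/sdecr/ltnW.
(* Once [s (h + p.+1)] is replaced by [s (h + p)], passing from [p] to [p.+1] adds the same quantity
   to both sides. *)
apply: (@le_trans _ _ (s (h + p)%N * G p.+1)).
  by rewrite ler_wpM2r ?G0// sdecr// leq_add2l.
have {IH} := IH (ltnW pk).
rewrite /weighted_sum /G addnS !big_nat_recr//= ?h2 ?leq_addr//.
rewrite -[p.+1%:R]natr1; lra.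
Qed.

(** Deterministic bias estimate: the factor [sqrt k] of the sum bound, divided by [k], leaves
    [1 / sqrt k]. *)
Lemma average_dist_le (e : nat -> R) (mu : R) (h k : nat) : (0 < k)%N ->
  (forall i, `|e i - mu| <= s i) ->
  `|k%:R^-1 * (\sum_(h <= i < h + k) e i) - mu| <=
  weighted_sum (h %/ 2) (h + k) / Num.sqrt k%:R.
Proof.
move=> k0 es; have k0R : 0 < k%:R :> R by rewrite ltr0n.
have q0 : 0 < Num.sqrt k%:R :> R by rewrite sqrtr_gt0.
have -> : k%:R^-1 * (\sum_(h <= i < h + k) e i) - mu =
    k%:R^-1 * \sum_(h <= i < h + k) (e i - mu).
  by rewrite sumrB sumr_const_nat addKn mulrBr -[mu *+ k]mulr_natl mulKf ?gt_eqF.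
rewrite normrM gtr0_norm ?invr_gt0// mulrC ler_pdivrMr//.
have kE : k%:R = Num.sqrt k%:R ^+ 2 :> R by rewrite sqr_sqrtr// ltW.
rewrite [X in _ * X]kE expr2 mulrA divfK ?gt_eqF// mulrC.
apply: le_trans (sum_le_weighted_sum h k); apply: le_trans (ler_norm_sum _ _ _) _.
by apply: ler_sum.
Qed.

End real_sums.

(** * Functions of a given set of variables *)

Section depends_on.
Context {d d' : measure_display} {T : measurableType d}
  {T' : measurableType d'} {R : realType} (P : probability T R) {I : choiceType}.
Variable Y : I -> {RV P >-> T'}.

(** The source type carries the sigma-algebra generated by the [Y i] with [i] in [J], so the usual
    measurability lemmas for pairs and compositions apply. *)
Definition depends_on {dS} {S : measurableType dS} (J : set I) (X : T -> S) :=
  measurable_fun [set: g_sigma_algebraType (cylinder Y J)] X.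

Lemma depends_on_sub {dS} {S : measurableType dS} J J' (X : T -> S) :
  J `<=` J' -> depends_on J X -> depends_on J' X.
Proof.
move=> JJ' JX _ B mB; apply: (sub_sigma_algebra2 (sub_cylinder JJ')).
exact: JX.
Qed.

Lemma depends_on_var J i : J i -> depends_on J (Y i).
Proof.
move=> Ji _ B mB; rewrite setTI; apply: sub_sigma_algebra.
exists [fset i]%fset, (fun=> B); split => //.
- by move=> j /=; rewrite in_fset1 => /eqP->.
- apply/seteqP; split => [w Bw j /=|w]; first by rewrite in_fset1 => /eqP->.
  by apply; rewrite /= in_fset1.
Qed.

Lemma depends_on_measurable {dS} {S : measurableType dS} J (X : T -> S) :
  depends_on J X -> measurable_fun [set: T] X.
Proof.
move=> JX _ B mB; apply: (@g_sigma_cylinder_measurable _ _ _ _ _ _ _ Y J).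
exact: JX.
Qed.

Lemma depends_on_independent {d1 d2} {S1 : measurableType d1}
    {S2 : measurableType d2} J1 J2 (X1 : T -> S1) (X2 : T -> S2) :
  mutually_independent P Y -> J1 `&` J2 = set0 ->
  depends_on J1 X1 -> depends_on J2 X2 -> independent P X1 X2.
Proof.
move=> indY J12 JX1 JX2 A B mA mB; apply: (g_sigma_cylinder_indep indY J12).
- by rewrite -[_ @^-1` _]setTI; exact: JX1.
- by rewrite -[_ @^-1` _]setTI; exact: JX2.
Qed.

End depends_on.

(** * Time invariance of the laws of the chain *)

Section chain_law.
Context {R : realType} {d dF dF' : measure_display} {T : measurableType d}
  {P : probability T R} {F : measurableType dF} {F' : measurableType dF'}.
Variables (g : F * F' -> F) (U : int -> {RV P >-> F'}) (x0 : F).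
Hypotheses (mg : measurable_fun [set: F * F'] g) (iidU : iid P U).

Local Notation X := (chain_from g x0 U).

Definition window (a b : int) : set int := [set i | a <= i < b].

Lemma chain_from_depends s n : depends_on U (window s (s + n%:Z)) (X s n).
Proof.
elim: n => [|n IH]; first exact: measurable_cst.
suff m : depends_on U (window s (s + n.+1%:Z))
    (fun w => (X s n w, U (s + n%:Z) w)) by exact: (measurableT_comp mg m).
apply: measurable_fun_pair.
  by apply: depends_on_sub IH => i /=; rewrite /window/=; lia.
by apply: depends_on_var; rewrite /window/=; lia.
Qed.

Lemma chain_from_measurable s n : measurable_fun [set: T] (X s n).
Proof. exact: (depends_on_measurable (@chain_from_depends s n)). Qed.

Lemma innovation_same_law i j : same_law P (U i) (U j).
Proof. by move=> A mA; have [_] := iidU; apply. Qed.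

(** By induction: the state after [n] steps uses only earlier innovations, hence is independent of
    the next one, whose law does not depend on time. *)
Lemma chain_from_same_law s s' n : same_law P (X s n) (X s' n).
Proof.
elim: n => [|n IH] //.
have ind t : independent P (X t n) (U (t + n%:Z)).
  apply: (depends_on_independent iidU.1 _ (@chain_from_depends t n)
    (depends_on_var (J := [set t + n%:Z]) _)) => //.
  by apply/seteqP; split => i //=; rewrite /window/= => -[ti iE]; lia.
apply: (same_law_comp mg); apply: same_law_pair IH _ => //.
- exact: chain_from_measurable.
- exact: chain_from_measurable.
- exact: innovation_same_law.
Qed.

(** From time [s + m] on, both chains read the same innovations, so the pair is itself a chain and
    the one-chain induction applies to it. *)
Lemma coupled_chains_same_law s s' m n :
  same_law P (fun w => (X s (m + n) w, X (s + m%:Z) n w))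
             (fun w => (X s' (m + n) w, X (s' + m%:Z) n w)).
Proof.
(* At [n = 0] the second chain has just been started at [x0], so the pair is a function of the first
   chain alone. *)
elim: n => [|n IH].
  rewrite addn0; apply: (@same_law_comp _ _ _ _ _ _ _ _ (X s m) (X s' m)
    (fun x => (x, x0))); last exact: chain_from_same_law.
  exact: measurable_fun_pair.
pose G (z : (F * F) * F') := (g (z.1.1, z.2), g (z.1.2, z.2)).
have mG : measurable_fun setT G.
  apply: measurable_fun_pair; apply: measurableT_comp => //;
  apply: measurable_fun_pair => //; exact: measurableT_comp.
pose Z t w := (X t (m + n) w, X (t + m%:Z) n w).
have ZS t : (fun w => (X t (m + n.+1) w, X (t + m%:Z) n.+1 w)) =
    G \o (fun w => (Z t w, U (t + (m + n)%:Z) w)).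
  by apply/funext => w; rewrite /G/= addnS /= -addrA -PoszD.
have depZ t : depends_on U (window t (t + (m + n)%:Z)) (Z t).
  apply: measurable_fun_pair; first exact: chain_from_depends.
  apply: depends_on_sub (@chain_from_depends (t + m%:Z) n) => i /=.
  by rewrite /window/=; lia.
have ind t : independent P (Z t) (U (t + (m + n)%:Z)).
  apply: (depends_on_independent iidU.1 _ (depZ t)
    (depends_on_var (J := [set t + (m + n)%:Z]) _)) => //.
  by apply/seteqP; split => i //=; rewrite /window/= => -[ti iE]; lia.
rewrite !ZS; apply: (same_law_comp mG); apply: same_law_pair IH _ => //.
- exact: (depends_on_measurable (depZ s)).
- exact: (depends_on_measurable (depZ s')).
- exact: ind.
- exact: ind.
- exact: innovation_same_law.
Qed.

Variables (f : F -> R) (nu : R^nat).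
Hypotheses (mf : measurable_fun [set: F] f)
  (f2 : forall i : nat, f \o chain g x0 U i \in Lfun P 2%:E)
  (nu_gt0 : forall i : nat, 0 < nu i)
  (nu_bound : forall i m : nat,
    ('E_P[fun w => ((f (shifted_chain g x0 U i%:Z m%:Z w)
                     - f (chain g x0 U i w)) ^+ 2)%R] <= (nu i)%:E)%E).

Local Notation V s n := (f \o X s n).

(** [f2] covers the starting time 0; equality in law carries the finite second moment to any
    starting time [s]. *)
Lemma chain_from_Lfun2 s n : V s n \in Lfun P 2%:E.
Proof.
have mV t : measurable_fun [set: T] (V t n).
  exact: (measurableT_comp mf (@chain_from_measurable t n)).
rewrite inE; apply/andP; split; first by rewrite inE; exact: mV.
rewrite inE/=; have := f2 n; rewrite inE => /andP[_]; rewrite inE/=.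
rewrite /finite_norm unlock.
pose h x : \bar R := (`|f x| `^ 2)%:E.
have mh : measurable_fun [set: F] h.
  apply/measurable_EFinP/(measurableT_comp (measurable_powR _)).
  exact: measurableT_comp.
rewrite (same_law_ge0_integral (h := h) (@chain_from_measurable 0 n)
  (@chain_from_measurable s n))//.
  by move=> x; rewrite lee_fin powR_ge0.
exact: chain_from_same_law.
Qed.

Lemma mean_chain_from s n : mean P (V s n) = mean P (V 0 n).
Proof.
rewrite /mean unlock; congr fine.
apply: (same_law_integral (h := EFin \o f)).
- exact: chain_from_measurable.
- exact: chain_from_measurable.
- exact/measurable_EFinP.
- exact: chain_from_same_law.
Qed.

(** A time shift to [s = - m] turns the pair into the shifted chain and the chain itself at time
    [n], where [nu_bound] applies. *)
Lemma coupled_chains_dist s m n :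
  mean P ((V s (m + n) - V (s + m%:Z) n) ^+ 2) <= nu n.
Proof.
pose h (z : F * F) := (((f z.1 - f z.2) ^+ 2)%:E : \bar R).
have mh : measurable_fun setT h.
  apply/measurable_EFinP; apply: measurable_funX; apply: measurable_funB;
  exact: measurableT_comp.
have mXX t : measurable_fun [set: T] (fun w => (X t (m + n) w, X (t + m%:Z) n w)).
  by apply: measurable_fun_pair; exact: chain_from_measurable.
have D1 : (V s (m + n) - V (s + m%:Z) n) * (V s (m + n) - V (s + m%:Z) n)
    \in Lfun P 1.
  by apply: Lfun2_mulr; apply: Lfun2B; exact: chain_from_Lfun2.
rewrite -lee_fin expr2 -meanE// unlock.
rewrite -expr2; apply: le_trans (nu_bound n m); rewrite unlock.
rewrite (_ : (\int[P]_w _)%E = (\int[P]_w h (X s (m + n) w, X (s + m%:Z) n w))%E)//.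
rewrite (same_law_ge0_integral (mXX s) (mXX (- m%:Z)) mh)//; last 2 first.
  by move=> z; rewrite lee_fin sqr_ge0.
  exact: coupled_chains_same_law.
rewrite addNr /shifted_chain /chain.
by rewrite (_ : absz (n%:Z + m%:Z) = (m + n)%N)// addnC.
Qed.

End chain_law.

(** * Dyadic approximation by truncated chains, and limit of the means *)

Section truncated_chain.
Context {R : realType} {d dF dF' : measure_display} {T : measurableType d}
  {P : probability T R} {F : measurableType dF} {F' : measurableType dF'}.
Variables (g : F * F' -> F) (U : int -> {RV P >-> F'}) (x0 : F).
Hypotheses (mg : measurable_fun [set: F * F'] g) (iidU : iid P U).
Variables (f : F -> R) (nu : R^nat).
Hypotheses (mf : measurable_fun [set: F] f)
  (f2 : forall i : nat, f \o chain g x0 U i \in Lfun P 2%:E)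
  (nu_gt0 : forall i : nat, 0 < nu i)
  (nu_bound : forall i m : nat,
    ('E_P[fun w => ((f (shifted_chain g x0 U i%:Z m%:Z w)
                     - f (chain g x0 U i w)) ^+ 2)%R] <= (nu i)%:E)%E).

(* Approximation of [f X_n] by the last [j] innovations only: the chain is
   restarted from [x0] at time [n - j] when [j <= n]. *)
Definition truncated (n j : nat) : T -> R :=
  f \o chain_from g x0 U (n%:Z - (minn j n)%:Z) (minn j n).

Local Notation Z := truncated.

Lemma truncated0 n : Z n 0 = cst (f x0).
Proof. by rewrite /truncated min0n. Qed.

Lemma truncated_full n j : (n <= j)%N -> Z n j = f \o chain g x0 U n.
Proof. by move=> nj; rewrite /truncated (minn_idPr nj) subrr. Qed.

Lemma truncated_Lfun2 n j : Z n j \in Lfun P 2%:E.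
Proof. exact: (chain_from_Lfun2 mg iidU mf f2). Qed.

Lemma truncated_depends n j : depends_on U (window (n%:Z - j%:Z) n%:Z) (Z n j).
Proof.
suff dep : depends_on U (window (n%:Z - j%:Z) n%:Z)
    (chain_from g x0 U (n%:Z - (minn j n)%:Z) (minn j n)).
  exact: (measurableT_comp mf dep).
apply: depends_on_sub (@chain_from_depends _ _ _ _ _ _ _ _ _ U x0 mg _ _) => i.
by rewrite /window/=; lia.
Qed.

(** For [j > n] both truncations are [f X_n]; otherwise they are coupled chains, the second
    restarted [minn j' n - j] steps after the first. *)
Lemma truncated_dist n j j' : (j <= j')%N ->
  mean P ((Z n j' - Z n j) ^+ 2) <= nu j.
Proof.
move=> jj'; have [jn|nj] := leqP j n; last first.
  rewrite !truncated_full ?(leq_trans _ jj') ?(ltnW nj)// subrr expr0n/=.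
  by rewrite [X in X <= _](_ : _ = 0) ?(ltW (nu_gt0 j))//; exact: mean_cst.
rewrite /truncated (minn_idPl jn).
have := coupled_chains_dist mg iidU mf f2 nu_bound
  (n%:Z - (minn j' n)%:Z) (minn j' n - j) j.
have -> : (minn j' n - j + j = minn j' n)%N by lia.
by have -> : n%:Z - (minn j' n)%:Z + (minn j' n - j)%:Z = n%:Z - j%:Z by lia.
Qed.

Variables (h k : nat).

Definition truncated_sum (j : nat) : T -> R :=
  \sum_(h <= n < h + k) centered P (Z n j).

Local Notation W := truncated_sum.

Lemma truncated_sum_Lfun2 j : W j \in Lfun P 2%:E.
Proof.
by apply: Lfun2_sum => n _; apply: centered_Lfun2; exact: truncated_Lfun2.
Qed.

Lemma truncated_sum0 : W 0 = 0.
Proof.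
rewrite /truncated_sum big1// => n _.
by rewrite truncated0 /centered mean_cst; apply/funext => w; rewrite !fctE subrr.
Qed.

(** Each increment depends on the last [j'] innovations, so increments at times at least [j'] apart
    have disjoint windows and are uncorrelated. *)
Lemma truncated_sum_step j j' : (j <= j')%N ->
  mean P ((W j' - W j) ^+ 2) <= k%:R * ((j'.*2).-1%:R * nu j).
Proof.
move=> jj'; pose D n := Z n j' - Z n j.
have D2 n : D n \in Lfun P 2%:E by apply: Lfun2B; exact: truncated_Lfun2.
have -> : W j' - W j = \sum_(h <= n < h + k) centered P (D n).
  rewrite -sumrB; apply: eq_bigr => n _.
  by rewrite centeredB ?Lfun21 ?truncated_Lfun2.
apply: mean_sqr_sum_le => [|n|n|n n' nn'].
- exact: ltW.
- exact: centered_Lfun2.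
- exact: le_trans (mean_sqr_centered_le (D2 n)) (truncated_dist n jj').
- have dep i : depends_on U (window (i%:Z - j'%:Z) i%:Z) (centered P (D i)).
    apply: measurable_funB; last exact: measurable_cst.
    apply: measurable_funB; first exact: truncated_depends.
    apply: depends_on_sub (@truncated_depends i j) => l /=.
    by rewrite /window/=; lia.
  rewrite independent_mean_mul ?centered_Lfun2//.
    by rewrite mean_centered ?mul0r// Lfun21.
  apply: (depends_on_independent iidU.1 _ (dep n) (dep n')).
  by apply/seteqP; split => l //=; rewrite /window/= => -[]; lia.
Qed.

(** Minkowski's inequality along the scales 0, 1, 2, 4, ...: the step from 0 to 1 gives the isolated
    term in [nu 0]. *)
Lemma truncated_sum_dyadic L : (0 < k)%N ->
  mean P (W (2 ^ L)%N ^+ 2) <=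
  (Num.sqrt k%:R * (Num.sqrt (nu 0) +
    \sum_(r < L) 2 * Num.sqrt (2 ^ r)%:R * Num.sqrt (nu (2 ^ r)%N))) ^+ 2.
Proof.
move=> k0; have sk0 : 0 < Num.sqrt k%:R :> R by rewrite sqrtr_gt0 ltr0n.
have sqnu i : Num.sqrt (nu i) ^+ 2 = nu i by rewrite sqr_sqrtr// ltW.
have snu i : 0 < Num.sqrt (nu i) by rewrite sqrtr_gt0.
elim: L => [|L IH].
  rewrite big_ord0 addr0 expn0 exprMn sqnu sqr_sqrtr//.
  have := truncated_sum_step (leq0n 1).
  by rewrite truncated_sum0 subr0 mul1r.
rewrite big_ord_recr/= addrA mulrDr -[W _](subrKC (W (2 ^ L)%N)).
have sum0 : 0 <= \sum_(r < L) 2 * Num.sqrt (2 ^ r)%:R * Num.sqrt (nu (2 ^ r)%N).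
  by apply: sumr_ge0 => r _; rewrite !mulr_ge0 ?sqrtr_ge0.
have step0 : 0 < Num.sqrt (2 ^ L)%:R :> R by rewrite sqrtr_gt0 ltr0n expn_gt0.
apply: mean_sqrD_le => //.
- exact: truncated_sum_Lfun2.
- by apply: Lfun2B; exact: truncated_sum_Lfun2.
- by rewrite mulr_gt0// ltr_wpDr.
- by rewrite !mulr_gt0.
have LL : (2 ^ L <= 2 ^ L.+1)%N by rewrite leq_exp2l.
apply: le_trans (truncated_sum_step LL) _.
(* The number of partners [2 * 2 ^ L.+1 - 1] is at most [4 * 2 ^ L], the square of
   [2 * sqrt (2 ^ L)]. *)
rewrite !exprMn sqnu !sqr_sqrtr// ler_wpM2l// ler_wpM2r ?(ltW (nu_gt0 _))//.
by rewrite -natrX -natrM ler_nat expnS; lia.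
Qed.

Local Notation s := (fun i => Num.sqrt (nu i)).

Lemma sqrt_nu_ge0 i : 0 <= s i. Proof. exact: sqrtr_ge0. Qed.

(** [X_i] has the law of the chain restarted at time [j - i] and run for [i] steps; that chain is
    coupled with [X_j], and [(E D) ^ 2 <= E (D ^ 2)] for the difference [D]. *)
Lemma mean_chain_dist i j : (i <= j)%N ->
  `|mean P (f \o chain g x0 U j) - mean P (f \o chain g x0 U i)| <= s i.
Proof.
move=> ij; have L2 t n := chain_from_Lfun2 mg iidU mf f2 t n.
rewrite -(mean_chain_from x0 mg iidU mf (0 + (j - i)%:Z) i) -meanB ?Lfun21//.
have := coupled_chains_dist mg iidU mf f2 nu_bound 0 (j - i) i.
rewrite subnK// => le_nu; rewrite -sqrtr_sqr ler_wsqrtr//.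
by apply: le_trans le_nu; apply: mean_sqr_ge; exact: Lfun2B.
Qed.

Hypothesis nu_decr : nonincreasing_seq nu.

Lemma sqrt_nu_decr : nonincreasing_seq s.
Proof. by move=> i j ij; rewrite ler_wsqrtr// nu_decr. Qed.

Lemma truncated_sum_le L : (0 < k)%N ->
  mean P (W (2 ^ L)%N ^+ 2) <= 16 * k%:R * weighted_sum s 0 (2 ^ L) ^+ 2.
Proof.
move=> k0; apply: le_trans (truncated_sum_dyadic L k0) _.
have := dyadic_sum_le sqrt_nu_ge0 sqrt_nu_decr L.
(* The dyadic bound has one more term, at scale [2 ^ L], which is nonnegative and dropped; 16 is the
   square of its constant 4. *)
rewrite big_ord_recr/=.
set S := \sum_(r < L) _ => le4.
have S0 : 0 <= S by apply: sumr_ge0 => r _; rewrite !mulr_ge0 ?sqrtr_ge0.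
have t0 : 0 <= 2 * Num.sqrt (2 ^ L)%:R * s (2 ^ L)%N.
  by rewrite !mulr_ge0 ?sqrtr_ge0.
have s00 := sqrt_nu_ge0 0.
rewrite exprMn sqr_sqrtr// mulrAC [leRHS]mulrC ler_wpM2l//.
rewrite [X in _ <= X](_ : _ = (4 * weighted_sum s 0 (2 ^ L)) ^+ 2); last by ring.
by rewrite ler_sqr ?nnegrE//; lra.
Qed.

Lemma weighted_sum_le_nubar j n :
  ((weighted_sum s j n)%:E <= nubar nu j)%E.
Proof.
rewrite /nubar; apply: le_trans (nneseries_lim_ge n _); last first.
  by move=> i _ _; rewrite lee_fin sqrtr_ge0.
rewrite sumEFin lee_fin; apply: ler_sum => i _.
by rewrite sqrtrM ?sqrtrV ?(ltW (nu_gt0 i)).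
Qed.

Hypothesis nu_sum : (nubar nu 0 < +oo)%E.

(** The weighted sum up to [n] is at least [sqrt n * s n] and stays below the finite [nubar nu 0],
    so [s n] is at most a constant over [sqrt n]. *)
Lemma sqrt_nu_small (eps : R) : 0 < eps -> \forall n \near \oo, s n <= eps.
Proof.
move=> eps0.
have nubar_fin : nubar nu 0 \is a fin_num.
  rewrite ge0_fin_numE// (le_trans _ (weighted_sum_le_nubar 0 0))//.
  by rewrite lee_fin weighted_sum_ge0//; exact: sqrt_nu_ge0.
pose B := fine (nubar nu 0).
have BE n : weighted_sum s 0 n <= B.
  by rewrite -lee_fin fineK// weighted_sum_le_nubar.
near=> n.
have n0 : 0 < n%:R :> R by near: n; exact: nbhs_infty_gtr.
have Bn : (B / eps) ^+ 2 <= n%:R by near: n; exact: nbhs_infty_ger.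
have q0 : 0 < Num.sqrt n%:R :> R by rewrite sqrtr_gt0.
have Bq : B / eps <= Num.sqrt n%:R.
  by rewrite (le_trans (ler_norm _))// -sqrtr_sqr ler_wsqrtr.
have := weighted_sum_ge sqrt_nu_ge0 sqrt_nu_decr 0 n.
have nE : n%:R = Num.sqrt n%:R ^+ 2 :> R by rewrite sqr_sqrtr// ltW.
rewrite subn0 [X in X * _]nE expr2 -mulrA ler_pM2l// => /le_trans/(_ (BE n)).
rewrite ler_pdivrMr// in Bq.
by move=> /le_trans/(_ Bq); rewrite ler_pM2l.
Unshelve. all: end_near. Qed.

(* The intervals of centre [E f(X_i)] and radius [sqrt (nu i)] meet pairwise,
   so the supremum of their lower ends belongs to all of them. *)
Lemma mean_chain_limit :
  exists mu, forall i, `|mean P (f \o chain g x0 U i) - mu| <= s i.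
Proof.
pose e i := mean P (f \o chain g x0 U i).
pose A := range (fun i => e i - s i).
have Aub i : ubound A (e i + s i).
  move=> _ [j _ <-]; have [ij|/ltnW ji] := leqP i j.
    have := mean_chain_dist ij; have := sqrt_nu_ge0 j.
    by rewrite -/(e _) -/(e _) ler_norml; lra.
  have := mean_chain_dist ji; have := sqrt_nu_ge0 i.
  by rewrite -/(e _) -/(e _) ler_norml; lra.
have A0 : A !=set0 by exists (e 0%N - s 0%N), 0%N.
exists (sup A) => i; rewrite ler_distl; apply/andP; split.
  by rewrite lerBlDr; exact: (ge_sup A0 (Aub i)).
by rewrite -lerBlDr; apply: ub_le_sup => //; [exists (e 0%N + s 0%N)|exists i].
Qed.

End truncated_chain.

(** * Limit of the means, bias and quadratic error of the averages *)

Theorem theorem2p1 (R : realType)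
  (d dF dF' : measure_display)
  (T : measurableType d) (P : probability T R)
  (F : measurableType dF) (F' : measurableType dF')
  (g : F * F' -> F) (mg : measurable_fun [set: F * F'] g)
  (U : int -> {RV P >-> F'}) (iidU : iid P U)
  (x0 : F)
  (f : F -> R) (mf : measurable_fun [set: F] f)
  (f2 : forall i : nat, f \o chain g x0 U i \in Lfun P 2%:E)
  (nu : R^nat) (nu_gt0 : forall i : nat, 0 < nu i)
  (nu_decr : nonincreasing_seq nu)
  (nu_sum : (\sum_(0 <= i <oo) (Num.sqrt (nu i / i.+1%:R))%:E < +oo)%E)
  (nu_bound : forall i m : nat,
    ('E_P[fun w => ((f (shifted_chain g x0 U i%:Z m%:Z w)
                     - f (chain g x0 U i w)) ^+ 2)%R] <= (nu i)%:E)%E) :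
  exists mu : R,
    [/\ 'E_P[f \o chain g x0 U h]%E @[h --> \oo] --> mu%:E,
        forall h : nat,
          (`|'E_P[f \o chain g x0 U h] - mu%:E| <= (Num.sqrt (nu h))%:E)%E,
        forall h k : nat, (0 < k)%N ->
          (`|'E_P[fun w =>
                (k%:R^-1 * \sum_(h <= i < h + k) f (chain g x0 U i w))%R]
             - mu%:E| <= nubar nu (h %/ 2)%N / (Num.sqrt k%:R)%:E)%E
      & forall h k : nat, (0 < k)%N ->
          ('E_P[fun w =>
              ((k%:R^-1 * (\sum_(h <= i < h + k) f (chain g x0 U i w)) - mu)
                 ^+ 2)%R] <= 26%:E * nubar nu 0 ^+ 2 / k%:R%:E)%E].
Proof.
have ge0s := sqrt_nu_ge0 nu; have decrs := sqrt_nu_decr nu_decr.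
set s := fun i => Num.sqrt (nu i) in ge0s decrs.
have [mu emu] := mean_chain_limit mg iidU mf f2 nu_bound.
pose e i := mean P (f \o chain g x0 U i).
have F1 i : f \o chain g x0 U i \in Lfun P 1 by exact: Lfun21.
have EE i : 'E_P[f \o chain g x0 U i]%E = (e i)%:E by exact: meanE.
have avgE h k : (fun w => k%:R^-1 * \sum_(h <= i < h + k) f (chain g x0 U i w)) =
    k%:R^-1 *: \sum_(h <= i < h + k) (f \o chain g x0 U i).
  by apply/funext => w; rewrite /GRing.scale/= fct_sumE.
have avg2 h k : k%:R^-1 *: \sum_(h <= i < h + k) (f \o chain g x0 U i)
    \in Lfun P 2%:E.
  by apply: Lfun2Z; apply: Lfun2_sum.
exists mu; split.
- under eq_fun do rewrite EE.
  apply/fine_cvgP; split; first by near=> n.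
  rewrite /comp/=.
  apply/cvgrPdist_le => eps eps0; near=> n.
  rewrite distrC; apply: le_trans (emu n) _.
  by near: n; exact: sqrt_nu_small.
- by move=> h; rewrite EE -EFinB lee_fin; exact: emu.
- move=> h k k0; have q0 : 0 < Num.sqrt k%:R :> R by rewrite sqrtr_gt0 ltr0n.
  rewrite avgE (meanE (Lfun21 (avg2 h k))) -EFinB.
  rewrite meanZ ?(Lfun21 (Lfun2_sum _))// mean_sum//.
  have := @average_dist_le _ _ ge0s decrs e mu h k k0 emu.
  rewrite -lee_fin => /le_trans; apply.
  rewrite inver gt_eqF// EFinM lee_pmul2r ?lte_fin ?invr_gt0//.
  exact: weighted_sum_le_nubar.
- move=> h k k0; have k0R : 0 < k%:R :> R by rewrite ltr0n.
  (* Any [L] with [h + k <= 2 ^ L] would do: at that scale no truncation is effective, and [W] is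
     the centered sum of the [f X_i]. *)
  pose L := (h + k)%N; have hkL : (h + k <= 2 ^ L)%N by rewrite ltnW// ltn_expl.
  pose W := truncated_sum g U x0 f h k (2 ^ L).
  (* The error of the average is [W / k + b] with [W] of mean zero, so its mean square is the
     variance part plus [b ^ 2]. *)
  pose b := k%:R^-1 * (\sum_(h <= i < h + k) e i) - mu.
  have W2 : W \in Lfun P 2%:E by exact: truncated_sum_Lfun2.
  pose B := weighted_sum s 0 (2 ^ L).
  have B0 : 0 <= B by exact: weighted_sum_ge0.
  have WB : mean P (W ^+ 2) <= 16 * k%:R * B ^+ 2 by exact: truncated_sum_le.
  (* Enlarging the range of the weighted sum to [0 <= i < 2 ^ L] compares the bias with the same [B]
     as the variance. *)
  have bB : `|b| <= B / Num.sqrt k%:R.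
    apply: (le_trans (@average_dist_le _ _ ge0s decrs e mu h k k0 emu)).
    rewrite ler_wpM2r ?invr_ge0 ?sqrtr_ge0//.
    apply: le_trans (le_weighted_sum ge0s 0 hkL).
    rewrite (@weighted_sum_cat _ s 0 (h %/ 2) (h + k)) ?lerDr ?weighted_sum_ge0//.
    by rewrite leq0n (leq_trans (leq_div h 2)) ?leq_addr.
  have mW : mean P W = 0.
    rewrite mean_sum => [|n _]; last first.
      by rewrite Lfun21 ?centered_Lfun2 ?truncated_Lfun2.
    by rewrite big1// => n _; rewrite mean_centered// Lfun21 ?truncated_Lfun2.
  have XE : (fun w => (k%:R^-1 * (\sum_(h <= i < h + k) f (chain g x0 U i w)) - mu)
      ^+ 2) = (k%:R^-1 *: W + cst b) ^+ 2.
    apply/funext => w; rewrite !fctE /GRing.scale/= /W/b /truncated_sum !fct_sumE.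
    rewrite addrA -mulrDr -big_split/=; congr ((_ * _ - _) ^+ 2).
    rewrite big_nat [RHS]big_nat; apply: eq_bigr => i /andP[_ ihk].
    rewrite /centered truncated_full; last by rewrite (leq_trans (ltnW ihk)).
    by rewrite !fctE subrK.
  have cW1 : k%:R^-1 *: W \in Lfun P 1 by exact/Lfun21/Lfun2Z.
  have WW1 : W * W \in Lfun P 1 by exact: Lfun2_mulr.
  have kW : (k%:R^-1 *: W) ^+ 2 = k%:R^-2 *: (W * W).
    by apply/funext => w; rewrite !fctE /GRing.scale/= -exprVn; ring.
  have X1 : (k%:R^-1 *: W + cst b) ^+ 2 \in Lfun P 1.
    have X2 : k%:R^-1 *: W + cst b \in Lfun P 2%:E.
      rewrite -[cst b]opprK; apply: Lfun2B; first exact: Lfun2Z.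
      exact: (Lfun_cst P (- b)).
    exact: Lfun2_mulr.
  rewrite XE (meanE X1) (mean_sqr_shift _ (Lfun2Z _ W2)) kW (meanZ _ WW1).
  rewrite (meanZ _ (Lfun21 W2)) mW.
  rewrite !mulr0 addr0 -expr2.
  (* The variance part is at most [16 * B ^ 2 / k] and the squared bias at most [B ^ 2 / k]; their
     sum, with constant 17, is below the bound with 26. *)
  apply: (@le_trans _ _ ((26 * B ^+ 2) / k%:R)%:E).
    rewrite lee_fin.
    have bB2 : b ^+ 2 <= B ^+ 2 / k%:R.
      rewrite -[b ^+ 2]real_normK ?num_real// -[k%:R]sqr_sqrtr ?ler0n//.
      by rewrite -expr_div_n ler_sqr ?nnegrE ?divr_ge0 ?sqrtr_ge0.
    have WB2 : k%:R^-2 * mean P (W ^+ 2) <= 16 * (B ^+ 2 / k%:R).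
      rewrite mulrC ler_pdivrMr ?exprn_gt0//.
      by apply: le_trans WB _; rewrite expr2 !mulrA mulfVK ?gt_eqF//; lra.
    have : 0 <= B ^+ 2 / k%:R by rewrite divr_ge0 ?sqr_ge0.
    by rewrite -mulrA; lra.
  rewrite EFinM EFinM inver gt_eqF//; apply: lee_wpmul2r.
    by rewrite lee_fin invr_ge0 ltW.
  apply: lee_wpmul2l => //; rewrite EFin_expe.
  have Bnubar := weighted_sum_le_nubar nu_gt0 0 (2 ^ L).
  by rewrite !expe2; apply: lee_pmul; rewrite ?lee_fin.
Unshelve. all: end_near. Qed.
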